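(* For any prime $p>3$, we have $$\sum_{k=0}^{(p+1)/2}(3k-1)\frac{\left(-\frac{1}{2}\right)_k^2\left(\frac{1}{2}\right)_k4^k}{k!^3}\equiv p-6p^3\left(\frac{-1}{p}\right)+2p^3\left(\frac{-1}{p}\right)E_{p-3}\pmod{p^4}.$$
   Context: $(x)_k=x(x+1)\cdots(x+k-1)$ denotes the Pochhammer symbol, with $(x)_0=1$; $(x)_k^2$ means $((x)_k)^2$. $\left(\frac{\cdot}{p}\right)$ is the Legendre symbol, so $\left(\frac{-1}{p}\right)=(-1)^{(p-1)/2}$. The Euler numbers $E_n$ are defined by $\sum_{n=0}^{\infty}E_n\frac{x^n}{n!}=\frac{2e^x}{e^{2x}+1}$ for $|x|<\frac{\pi}{2}$. A congruence modulo $p^4$ between rational numbers is understood in the ring of $p$-adic integers (equivalently, in the ring of rationals with denominator prime to $p$). *)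

(* Defs.v *)
From HB Require Import structures.
From mathcomp Require Import all_boot all_order all_algebra.
From mathcomp Require Import all_classical all_reals all_analysis.

Set Implicit Arguments.
Unset Strict Implicit.
Unset Printing Implicit Defensive.

Import Order.TTheory GRing.Theory Num.Theory.
Import numFieldNormedType.Exports.

Local Open Scope classical_set_scope.
Local Open Scope ring_scope.

Definition pochhammer (x : rat) (k : nat) : rat := \prod_(i < k) (x + i%:R).

Definition legendre (a : int) (p : nat) : int :=
  if (p %| a)%Z then 0
  else if [exists x : 'I_p, (x%:Z ^+ 2 == a %[mod p])%Z] then 1 else -1.

(* The generating function determines E uniquely, so this predicate singles
   out the sequence of Euler numbers. Convergence of the series on the whole
   interval is part of the condition. *)
Definition is_euler_numbers (R : realType) (E : nat -> rat) : Prop :=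
  forall x : R, `|x| < pi / 2 ->
    series (fun n : nat => ratr (E n) * (x ^+ n / n`!%:R)) @ \oo -->
      2 * expR x / (expR (2 * x) + 1).

(* denq is the positive denominator of the reduced fraction, so for p prime
   these are the rationals that are p-adic integers. *)
Definition p_integral (p : nat) (x : rat) : bool := coprime p `|denq x|%N.

(* x = y modulo m in the ring of p-integral rationals; membership of x and y
   in that ring is required. *)
Definition p_congr (p m : nat) (x y : rat) : Prop :=
  [/\ p_integral p x, p_integral p y &
      exists2 z : rat, p_integral p z & x - y = m%:R * z].

(* Main.v *)
(** Proof idea. Up to a telescoping (Gosper) term, which produces the
    [-6 p^3 (-1/p)], the sum is [f 0], where for [p = 2n+1]

      [f Y = sum_(k <= n) (3k+1) C(2k,k) prod_(i < k) ((2i+1)^2 - Y) / (4 ((i+1)^2 - Y))].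

    The odd values of [i+1] cancel in the denominators, so [f] has poles only at
    the [(2m)^2] with [1 <= m <= M = n/2], and [P f] is a polynomial of degree at
    most [M], where [P Y = prod_(m = 1..M) (1 - Y / (2m)^2)]. A WZ pair gives
    [f ((2j+1)^2) = 2j+1] for [n/2 <= j <= n]. Lagrange interpolation of [P f] at
    the nodes [(p-2i)^2], [0 <= i <= M], expresses [f 0] exactly. Modulo [p^4] the
    term [i = 0] is [p], and the term [i > 0] is [p^3 / (2 i^2)]. Hence [f 0] is
    [p + p^3/2 (sum_(i = 1..M) 1/i^2)], and the last sum is congruent to
    [4 (-1/p) E_(p-3)] modulo [p] because the Euler numbers generate alternating
    power sums of odd integers. *)

Require Import Defs.
From HB Require Import structures.
From mathcomp Require Import all_boot all_order all_algebra.
From mathcomp Require Import all_classical all_reals all_analysis.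
From mathcomp Require Import ring lra zify.

Set Implicit Arguments.
Unset Strict Implicit.
Unset Printing Implicit Defensive.

Import Order.TTheory GRing.Theory Num.Theory.
Import numFieldNormedType.Exports.

Local Open Scope ring_scope.

(** * A WZ pair *)

Lemma fact_neq0 (n : nat) : (n`!%:R : rat) != 0.
Proof. by rewrite pnatr_eq0 -lt0n fact_gt0. Qed.

Lemma natS_neq0 (n : nat) : (n%:R + 1 : rat) != 0.
Proof. by rewrite natr1 pnatr_eq0. Qed.

Lemma natr_neq0 (m : nat) : (0 < m)%N -> (m%:R : rat) != 0.
Proof. by rewrite pnatr_eq0 -lt0n. Qed.

(** For [k <= j] this is the [k]-th summand of [param_sum] at [Y = (2j+1)^2], divided by [2j+1]. *)
Definition wz_term (j k : nat) : rat :=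
  (3 * k%:R + 1) * 'C(k.*2, k)%:R * ((j.*2 - k)`!%:R * (j + k)`!%:R)
  / ((j - k)`!%:R * (j.*2 + k).+1`!%:R).

(* The WZ certificate [wz_mate j k / wz_term j k] is
   [-2 k^2 (2j+1-k) / ((3k+1) (j+1-k) (2j+2+k))]. *)
Definition wz_mate (j k : nat) : rat :=
  - (2 * k%:R ^+ 2 * 'C(k.*2, k)%:R * ((j.*2.+1 - k)`!%:R * (j + k)`!%:R)
  / ((j.+1 - k)`!%:R * (j.*2 + k).+2`!%:R)).

Lemma central_binS (k : nat) :
  (k%:R + 1) * 'C(k.+1.*2, k.+1)%:R = 2 * (2 * k%:R + 1) * 'C(k.*2, k)%:R :> rat.
Proof.
have E m : 'C(m.*2, m)%:R = (m.*2)`!%:R / (m`!%:R ^+ 2) :> rat.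
  have h := @bin_fact m.*2 m; rewrite -addnn leq_addr addnK in h.
  by rewrite -addnn -(h isT) natrM natrM -expr2 mulfK ?expf_neq0 ?fact_neq0.
rewrite !E doubleS !factS !natrM -!natr1 -addnn natrD.
by field; rewrite ?fact_neq0 ?natS_neq0.
Qed.

Lemma wz_pair (j k : nat) : (k <= j)%N ->
  wz_term j.+1 k - wz_term j k = wz_mate j k.+1 - wz_mate j k.
Proof.
(* With [j = d + k] every truncated subtraction becomes a sum, and [factS] reduces all factorials to
   a few common ones. *)
move=> /subnK<-; move: (j - k)%N => d.
have hC : 'C(k.+1.*2, k.+1)%:R
  = 2 * (2 * k%:R + 1) / (k%:R + 1) * 'C(k.*2, k)%:R :> rat.
  by apply: (mulfI (natS_neq0 k)); rewrite central_binS; field; exact: natS_neq0.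
rewrite /wz_term /wz_mate hC.
have -> : ((d + k).+1.*2 - k = (d + d + k).+2)%N by lia.
have -> : ((d + k).*2 - k = d + d + k)%N by lia.
have -> : ((d + k).*2.+1 - k.+1 = d + d + k)%N by lia.
have -> : ((d + k).*2.+1 - k = (d + d + k).+1)%N by lia.
have -> : ((d + k).+1.*2 + k = ((d + k).*2 + k).+2)%N by lia.
have -> : ((d + k).*2 + k.+1 = ((d + k).*2 + k).+1)%N by lia.
have -> : ((d + k).+1 - k = d.+1)%N by lia.
have -> : ((d + k).+1 - k.+1 = d)%N by lia.
have -> : ((d + k) - k = d)%N by lia.
rewrite !addSn !addnS !factS !natrM -!natr1 -!addnn !natrD.
field; rewrite -?natrD ?fact_neq0 /=.
by rewrite !(natr1, =^~ natrD, =^~ natrM, pnatr_eq0, =^~ mulrS) .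
Qed.

(** By [wz_pair] the difference between [j+1] and [j] telescopes over [k <= j]. The extra summand
    [k = j+1] cancels [wz_mate j j.+1], and [wz_mate j 0] vanishes through its factor [k^2]. *)
Lemma wz_sum (j : nat) : \sum_(k < j.+1) wz_term j k = 1.
Proof.
elim: j => [|j IH].
  by rewrite big_ord_recl big_ord0 /wz_term.
rewrite -[RHS]IH; apply/eqP; rewrite -subr_eq0 big_ord_recr /= addrAC -sumrB.
rewrite (eq_bigr (fun k : 'I_j.+1 => wz_mate j k.+1 - wz_mate j k)); last first.
  by move=> k _; rewrite wz_pair // -ltnS.
rewrite -(big_mkord xpredT (fun k => wz_mate j k.+1 - wz_mate j k)).
rewrite telescope_sumr // /wz_term /wz_mate.
have -> : (j.+1.*2 - j.+1 = j.+1)%N by lia.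
have -> : (j.*2.+1 - j.+1 = j)%N by lia.
have -> : (j.+1.*2 + j.+1 = (j.*2 + j).+3)%N by lia.
have -> : (j.*2 + j.+1 = (j.*2 + j).+1)%N by lia.
have -> : (j.+1 + j.+1 = (j + j.+1).+1)%N by lia.
rewrite subnn !expr0n /= mulr0 !mul0r oppr0 subr0 !factS !natrM -!natr1 -!addnn !natrD.
apply/eqP; field; rewrite -?natrD ?fact_neq0 /=.
by rewrite !(natr1, =^~ natrD, =^~ natrM, pnatr_eq0, =^~ mulrS) .
Qed.

(** * The interpolated rational function *)

(** The difference of [q] and its interpolant has size at most [m] but [m] distinct roots. *)
Lemma lagrange_horner (F : fieldType) (m : nat) (y : nat -> F) (q : {poly F}) (z : F) :
  (forall i j, (i < m)%N -> (j < m)%N -> y i = y j -> i = j) ->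
  (size q <= m)%N ->
  q.[z] = \sum_(i < m) q.[y i] * \prod_(l < m | l != i) ((z - y l) / (y i - y l)).
Proof.
move=> inj_y size_q.
pose c i := \prod_(l < m | l != i) (y i - y l)^-1.
pose r := \sum_(i < m) (q.[y i] * c i) *: \prod_(l < m | l != i) ('X - (y l)%:P).
have rE x : r.[x] = \sum_(i < m) q.[y i] * \prod_(l < m | l != i) ((x - y l) / (y i - y l)).
  rewrite horner_sum; apply: eq_bigr => i _.
  rewrite hornerZ horner_prod -mulrA; congr (_ * _).
  rewrite /c mulrC -big_split /=; apply: eq_bigr => l ne_l.
  by rewrite !hornerE.
rewrite -rE; congr (_.[z]); apply/eqP; rewrite -subr_eq0; apply/negPn/negP => nz.
have roots : all (root (q - r)) [seq y i | i <- iota 0 m].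
  apply/allP => x /mapP[i]; rewrite mem_iota add0n => /andP[_ lt_im] ->.
  rewrite rootE hornerD hornerN subr_eq0 rE.
  rewrite (bigD1 (Ordinal lt_im)) //= [X in _ == _ + X]big1 => [|l ne_li].
    rewrite addr0 big1 ?mulr1 // => l ne_l.
    rewrite divff // subr_eq0; apply: contra ne_l => /eqP/inj_y h.
    by apply/eqP/val_inj => /=; rewrite h.
  rewrite (bigD1 (Ordinal lt_im)) 1?eq_sym //= subrr !mul0r mulr0 //.
have uniq_y : uniq [seq y i | i <- iota 0 m].
  rewrite map_inj_in_uniq ?iota_uniq // => i j.
  by rewrite !mem_iota !add0n => /andP[_ ?] /andP[_ ?]; apply: inj_y.
have := max_poly_roots nz roots uniq_y; rewrite size_map size_iota ltnNge.
suff -> : (size (q - r)%R <= m)%N by [].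
rewrite (leq_trans (size_polyD _ _)) // geq_max size_q size_polyN.
apply: (leq_trans (size_sum _ _ _)); apply/bigmax_leqP => i _.
rewrite (leq_trans (size_scale_leq _ _)) // -big_filter size_prod_XsubC.
rewrite -sum1_size big_filter sum1_card cardC1 card_ord prednK //.
by case: (m) i => [[]|].
Qed.

Definition pole_poly (M : nat) : {poly rat} :=
  \prod_(m < M) (1 - ((2 * m.+1%:R) ^- 2) *: 'X).

Definition param_factor (i : nat) (Y : rat) : rat :=
  ((2 * i%:R + 1) ^+ 2 - Y) / (4 * (i.+1%:R ^+ 2 - Y)).

Definition param_sum (n : nat) (Y : rat) : rat :=
  \sum_(k < n.+1) (3 * k%:R + 1) * 'C(k.*2, k)%:R * \prod_(i < k) param_factor i Y.

(** At this point the factor [i] is [(j-i)(j+i+1) / ((2j-i)(2j+i+2))], so the product is a quotient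
    of factorials. *)
Lemma prod_param_factor (j k : nat) : (k <= j)%N ->
  \prod_(i < k) param_factor i ((2 * j%:R + 1) ^+ 2) =
  (2 * j%:R + 1) * ((j.*2 - k)`!%:R * (j + k)`!%:R)
    / ((j - k)`!%:R * (j.*2 + k).+1`!%:R).
Proof.
elim: k => [|k IH] lt_kj.
  have -> : 2 * j%:R + 1 = j.*2.+1%:R :> rat by rewrite -[RHS]natr1 -mul2n natrM.
  rewrite big_ord0 !subn0 !addn0 factS natrM.
  by field; rewrite ?fact_neq0 addrC natS_neq0.
rewrite big_ord_recr /= IH 1?ltnW // /param_factor.
move: lt_kj => /subnK<-; move: (j - k.+1)%N => d.
have -> : ((d + k.+1).*2 - k = (d + d + k).+2)%N by lia.
have -> : ((d + k.+1).*2 - k.+1 = (d + d + k).+1)%N by lia.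
have -> : ((d + k.+1) - k = d.+1)%N by lia.
have -> : ((d + k.+1) - k.+1 = d)%N by lia.
rewrite !addnS !doubleS !addSn !factS !natrM -!natr1 -!addnn !natrD.
field; rewrite ?fact_neq0 -?natrD /=.
rewrite !(natr1, =^~ natrD, =^~ natrM, pnatr_eq0, =^~ mulrS) /= !andbT.
rewrite subr_sqr mulf_eq0 negb_or.
rewrite subr_eq0 eqr_nat -natrD pnatr_eq0; lia.
Qed.

(** The factor [i = j] vanishes at this point, which kills the summands with [k > j]; the others are
    [2j+1] times those of [wz_sum]. *)
Lemma param_sum_odd_square (n j : nat) : (j <= n)%N -> (n <= j.*2)%N ->
  param_sum n ((2 * j%:R + 1) ^+ 2) = 2 * j%:R + 1.
Proof.
move=> le_jn le_n2j; rewrite -[RHS]mulr1 -[X in _ = _ * X](wz_sum j) mulr_sumr /param_sum.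
rewrite -(big_mkord xpredT (fun k => (3 * k%:R + 1) * 'C(k.*2, k)%:R *
   \prod_(i < k) param_factor i ((2 * j%:R + 1) ^+ 2))).
rewrite (@big_cat_nat _ _ _ j.+1) //= [X in _ + X]big1_seq ?addr0.
  rewrite big_mkord; apply: eq_bigr => k _.
  rewrite prod_param_factor; last by rewrite -ltnS.
  by rewrite /wz_term; ring.
move=> k; rewrite mem_index_iota => /= /andP[lt_jk _].
by rewrite (bigD1 (Ordinal lt_jk)) //= {1}/param_factor subrr !mul0r mulr0.
Qed.

(** The condition on [Y] also excludes the removable poles, where division by zero yields [0] and
    [param_sum] need not agree with the rational function. *)
Lemma param_sum_poly (n : nat) : exists2 q : {poly rat},
  (size q <= n./2.+1)%N &
  forall Y : rat, (forall i, (i < n)%N -> Y != i.+1%:R ^+ 2) ->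
    q.[Y] = (pole_poly n./2).[Y] * param_sum n Y.
Proof.
set M := n./2.
pose num k : {poly rat} := \prod_(i < k) (((2 * i%:R + 1) ^+ 2)%:P - 'X).
pose den k : {poly rat} := \prod_(i < k) ('X - (i.+1%:R ^+ 2)%:P).
have size_den k : size (den k) = k.+1.
  by rewrite size_prod_XsubC [index_enum _]unlock -enumT size_enum_ord.
have size_num k : (size (num k) <= k.+1)%N.
  elim: k => [|k IH]; first by rewrite /num big_ord0 size_poly1.
  rewrite /num big_ord_recr -/(num k) /= (leq_trans (size_polyMleq _ _)) //.
  by rewrite -opprB size_polyN size_XsubC addnC.
have size_P : (size (pole_poly M) <= M.+1)%N.
  rewrite /pole_poly; elim: (M) => [|k IH]; first by rewrite big_ord0 size_poly1.
  rewrite big_ord_recr /= (leq_trans (size_polyMleq _ _)) //.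
  have : (size (1 - (2 * k.+1%:R) ^- 2 *: 'X : {poly rat})%R <= 2)%N.
    rewrite (leq_trans (size_polyD _ _)) // geq_max size_poly1 /= size_polyN.
    by rewrite (leq_trans (size_scale_leq _ _)) // size_polyX.
  by move=> h2; have := leq_add IH h2; rewrite addn2; case: (_ + _)%N.
(* The roots [(i+1)^2] of [den k] are distinct. For [i+1] odd such a root is a root of [num k], for
   [i+1] even it is a root of [pole_poly M]. *)
have dvd k : (k <= n)%N -> den k %| pole_poly M * num k.
  move=> le_kn.
  have -> : den k = \prod_(z <- [seq i.+1%:R ^+ 2 | i <- index_iota 0 k]) ('X - z%:P).
    by rewrite /den big_map big_mkord.
  apply: uniq_roots_dvdp; last first.
    rewrite uniq_rootsE map_inj_uniq ?iota_uniq // => i j /eqP.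
    by rewrite eqrXn2 ?ler0n // eqr_nat => /eqP[].
  apply/allP => z /mapP[i]; rewrite mem_index_iota => /andP[_ lt_ik] ->.
  have e2 : i.+1%:R = i.+1./2%:R * 2 + (odd i.+1)%:R :> rat.
    by rewrite -natrM -natrD; congr _%:R; lia.
  rewrite rootM; case: (boolP (odd i.+1)) e2 => [odd_i|even_i] e2; apply/orP; [right|left].
    have lt_k : (i.+1./2 < k)%N by lia.
    rewrite rootE /num horner_prod (bigD1 (Ordinal lt_k)) //= !hornerE.
    have <- : i.+1%:R = 2 * i.+1./2%:R + 1 :> rat by rewrite {1}e2 mulrC.
    by rewrite subrr mul0r.
  have lt_M : (i.+1./2.-1 < M)%N by rewrite /M; lia.
  rewrite rootE /pole_poly horner_prod (bigD1 (Ordinal lt_M)) //=.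
  rewrite hornerD hornerN hornerZ hornerX -[1]/(1%:P) hornerC prednK; last by lia.
  have <- : i.+1%:R = 2 * i.+1./2%:R :> rat by rewrite {1}e2 addr0 mulrC.
  by rewrite mulVf ?subrr ?mul0r // expf_neq0 // pnatr_eq0.
(* The sign in [(-4)^-k] comes from the factors of [den k], which are opposite to those of
   [param_factor]. Dividing by [den k], of degree [k], leaves degree at most [M + k - k]. *)
exists (\sum_(k < n.+1) ((3 * k%:R + 1) * 'C(k.*2, k)%:R * ((- 4) ^- k)) *:
          ((pole_poly M * num k) %/ den k)).
  apply: (leq_trans (size_sum _ _ _)); apply/bigmax_leqP => k _.
  rewrite (leq_trans (size_scale_leq _ _)) // size_divp; last first.
    by rewrite -size_poly_gt0 size_den.
  rewrite size_den leq_subLR (leq_trans (size_polyMleq _ _)) //.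
  by have := leq_add size_P (size_num k); move: (_ + size _)%N => s; lia.
move=> Y ne_Y; rewrite horner_sum mulr_sumr; apply: eq_bigr => k _.
have le_kn : (k <= n)%N by rewrite -ltnS.
have nz i : (i < k)%N -> Y - i.+1%:R ^+ 2 != 0.
  by move=> lt_ik; rewrite subr_eq0 ne_Y // (leq_trans lt_ik).
have den_nz : (den k).[Y] != 0.
  rewrite horner_prod; apply/prodf_neq0 => i _.
  by rewrite !hornerE nz.
rewrite hornerZ -[LHS]mulrA [RHS]mulrCA; congr (_ * _).
apply: (mulIf den_nz); rewrite -[LHS]mulrA -hornerM divpK ?dvd // hornerM mulrCA -mulrA.
congr (_ * _); rewrite /num /den !horner_prod -[(- 4) ^- k]exprVn.
rewrite -{1}[k : nat]card_ord -prodr_const -!big_split /=.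
apply: eq_bigr => i _; rewrite !hornerE /param_factor.
have := nz i (ltn_ord i) => nzi.
have nzi' : i.+1%:R ^+ 2 - Y != 0 by rewrite -opprB oppr_eq0.
by field; rewrite -mulrS.
Qed.

(** The nodes are the [(2j+1)^2] with [j = n - i], where [j <= n <= 2j]. Since [s i > n], they avoid
    the excluded points, and [pole_poly] is [1] at [0]. *)
Lemma param_sum_lagrange (n : nat) :
  let s i : rat := n.*2.+1%:R - 2 * i%:R in
  param_sum n 0 = \sum_(i < n./2.+1) s i * (pole_poly n./2).[s i ^+ 2]
     * \prod_(l < n./2.+1 | l != i) (s l ^+ 2 / (s l ^+ 2 - s i ^+ 2)).
Proof.
move=> s; set M := n./2.
have sE i : (i <= M)%N -> s i = 2 * (n - i)%:R + 1.
  move=> le_iM; rewrite natrB; last by rewrite (leq_trans le_iM) // /M; lia.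
  by rewrite /s -addn1 natrD -mul2n natrM; ring.
have s_odd i : (i <= M)%N -> s i = (2 * (n - i) + 1)%:R by move=> /sE->; rewrite natrD natrM.
have [q size_q qE] := param_sum_poly n.
have q0 : q.[0] = param_sum n 0.
  rewrite qE => [|i _]; last by rewrite eq_sym expf_neq0 // pnatr_eq0.
  rewrite horner_prod big1 ?mul1r // => i _.
  by rewrite hornerD hornerN hornerZ hornerX mulr0 oppr0 addr0 hornerC.
rewrite -q0 (@lagrange_horner _ M.+1 (fun i => s i ^+ 2)) //; last first.
  move=> i j; rewrite !ltnS => le_i le_j /eqP.
  rewrite !s_odd // eqrXn2 ?ler0n // eqr_nat => /eqP; rewrite /M in le_i le_j *; lia.
apply: eq_bigr => i _; have le_iM : (i <= M)%N by rewrite -ltnS.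
rewrite qE => [|m lt_mn]; last first.
  rewrite s_odd // eqrXn2 ?ler0n // eqr_nat; move: (nat_of_ord i) le_iM; rewrite /M; lia.
rewrite {2}sE // param_sum_odd_square ?leq_subr //; last first.
  by move: (nat_of_ord i) le_iM; rewrite /M; lia.
rewrite -sE // [_ * s i]mulrC; congr (_ * _); apply: eq_bigr => l _.
by rewrite sub0r -[in RHS]opprB invrN mulrN mulNr.
Qed.

(** * Congruences between p-integral rationals *)

(* [b = 0] does no harm: [coprime p 0] holds only for [p = 1]. *)
Lemma p_integralP (p : nat) (x : rat) :
  reflect (exists (a : int) (b : nat), coprime p b /\ x = a%:~R / b%:R) (p_integral p x).
Proof.
apply: (iffP idP) => [cop|[a [b [cop ->]]]].
  exists (numq x), `|denq x|%N; split=> //.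
  by rewrite -[LHS]divq_num_den -[in LHS]absz_denq.
have [->|b_neq0] := eqVneq b 0%N.
  by rewrite invr0 mulr0; exact: coprimen1.
apply: coprime_dvdr cop.
have b_nz : (b%:R : rat) != 0 by rewrite pnatr_eq0.
have e : a * denq (a%:~R / b%:R) = numq (a%:~R / b%:R) * b%:Z.
  apply/eqP; rewrite -(eqr_int rat) !intrM numqE /=.
  by apply/eqP; field.
(* As [numq] and [denq] are coprime, [a * denq = numq * b] makes [denq] a divisor of [b]. *)
rewrite -(@Gauss_dvdr _ `|numq (a%:~R / b%:R)|%N); last first.
  by rewrite coprime_sym coprime_num_den.
apply/dvdnP; exists `|a|%N; rewrite -abszM e abszM //.
Qed.

Lemma p_integral_subring (p : nat) : subring_closed (p_integral p).
Proof.
split=> [|x y|x y]; first exact: coprimen1.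
- move=> /p_integralP[a [b [cb ->]]] /p_integralP[c [d [cd ->]]].
  have [->|b_neq0] := eqVneq b 0%N.
    rewrite invr0 mulr0 sub0r; apply/p_integralP; exists (- c), d.
    by rewrite rmorphN mulNr.
  have [->|d_neq0] := eqVneq d 0%N.
    rewrite invr0 mulr0 subr0; apply/p_integralP; by exists a, b.
  apply/p_integralP; exists (a * d%:Z - c * b%:Z), (b * d)%N; split.
    by rewrite coprimeMr cb.
  rewrite natrM rmorphB !rmorphM /=.
  by field; rewrite ?pnatr_eq0 ?b_neq0 ?d_neq0.
move=> /p_integralP[a [b [cb ->]]] /p_integralP[c [d [cd ->]]].
apply/p_integralP; exists (a * c), (b * d)%N; split; first by rewrite coprimeMr cb.
by rewrite natrM rmorphM /= invfM; ring.
Qed.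

HB.instance Definition _ (p : nat) := GRing.isSubringClosed.Build rat (p_integral p)
  (p_integral_subring p).

Lemma p_integralV (p m : nat) : coprime p m -> m%:R^-1 \in p_integral p.
Proof. by move=> cop; apply/p_integralP; exists 1, m; rewrite mul1r. Qed.

(** Unlike in [p_congr], the two sides need not be [p]-integral; [p_cong_integral] carries
    integrality from one side to the other. *)
Definition p_cong (p k : nat) (x y : rat) : bool := (x - y) / p%:R ^+ k \in p_integral p.
Section Congruence.
Variable p : nat.
Hypothesis p_gt0 : (0 < p)%N.
Let p_nz : (p%:R : rat) != 0. Proof. by rewrite pnatr_eq0 -lt0n. Qed.
Implicit Types (x y z : rat) (k : nat).

Lemma p_congP k x y :
  reflect (exists2 z, z \in p_integral p & x = y + p%:R ^+ k * z) (p_cong p k x y).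
Proof.
have pk_nz : (p%:R ^+ k : rat) != 0 by rewrite expf_neq0.
apply: (iffP idP) => [h|[z hz ->]].
  by exists ((x - y) / p%:R ^+ k) => //; rewrite mulrC divfK // addrC subrK.
by rewrite /p_cong addrC addKr mulrC mulKf.
Qed.

Lemma p_cong_refl k x : p_cong p k x x.
Proof. by rewrite /p_cong subrr mul0r rpred0. Qed.

Lemma p_cong_sym k x y : p_cong p k x y -> p_cong p k y x.
Proof. by rewrite /p_cong -opprB mulNr rpredN. Qed.

Lemma p_cong_trans k y x z : p_cong p k x y -> p_cong p k y z -> p_cong p k x z.
Proof.
rewrite /p_cong => hx hy; rewrite -(subrK y x) -addrA mulrDl; exact: rpredD.
Qed.

Lemma p_congD k x y x' y' :
  p_cong p k x y -> p_cong p k x' y' -> p_cong p k (x + x') (y + y').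
Proof.
rewrite /p_cong => hx hy.
by rewrite opprD addrACA mulrDl rpredD.
Qed.

Lemma p_congN k x y : p_cong p k x y -> p_cong p k (- x) (- y).
Proof. by rewrite /p_cong -opprD mulNr rpredN. Qed.

Lemma p_cong_sum k (I : Type) (r : seq I) (P : pred I) (F G : I -> rat) :
  (forall i, P i -> p_cong p k (F i) (G i)) ->
  p_cong p k (\sum_(i <- r | P i) F i) (\sum_(i <- r | P i) G i).
Proof.
move=> h; elim/big_ind2: _ => //; first exact: p_cong_refl.
by move=> *; apply: p_congD.
Qed.

Lemma p_cong_integral k x y : p_cong p k x y -> y \in p_integral p -> x \in p_integral p.
Proof. by move=> /p_congP[z hz ->] hy; rewrite rpredD // rpredM // rpredX // rpred_nat. Qed.

Lemma p_congM k x y x' y' : y \in p_integral p -> x' \in p_integral p ->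
  p_cong p k x y -> p_cong p k x' y' -> p_cong p k (x * x') (y * y').
Proof.
move=> iy ix' hx hy; rewrite /p_cong.
have -> : x * x' - y * y' = (x - y) * x' + y * (x' - y') by ring.
by rewrite mulrDl mulrAC -[y * _ / _]mulrA rpredD // rpredM.
Qed.

Lemma p_congMl k z x y : z \in p_integral p -> p_cong p k x y -> p_cong p k (z * x) (z * y).
Proof. by move=> iz h; rewrite /p_cong -mulrBr -mulrA rpredM. Qed.

Lemma p_congX k x y m : y \in p_integral p -> p_cong p k x y -> p_cong p k (x ^+ m) (y ^+ m).
Proof.
move=> iy h; have ix := p_cong_integral h iy; elim: m => [|m IH].
  exact: p_cong_refl.
by rewrite !exprS p_congM // rpredX.
Qed.

Lemma p_cong_prod1 k (I : Type) (r : seq I) (P : pred I) (F : I -> rat) :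
  (forall i, P i -> p_cong p k (F i) 1) -> p_cong p k (\prod_(i <- r | P i) F i) 1.
Proof.
move=> h; elim/big_ind: _ => //; first exact: p_cong_refl.
by move=> x y hx hy; rewrite -[1]mulr1 p_congM // ?rpred1 // (p_cong_integral hy) ?rpred1.
Qed.

Lemma p_cong_scale j k x y : p_cong p k x y -> p_cong p (j + k) (p%:R ^+ j * x) (p%:R ^+ j * y).
Proof.
by rewrite /p_cong -mulrBr exprD -mulf_div divff ?mul1r // expf_neq0.
Qed.

Lemma p_cong_divisible k x : x \in p_integral p -> p_cong p k (p%:R ^+ k * x) 0.
Proof. by move=> ix; rewrite /p_cong subr0 mulrAC divff ?mul1r // expf_neq0. Qed.

Lemma p_congV k x y : x != 0 -> y != 0 ->
  x^-1 \in p_integral p -> y^-1 \in p_integral p ->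
  p_cong p k x y -> p_cong p k x^-1 y^-1.
Proof.
move=> x0 y0 ix iy; rewrite /p_cong => h.
have pk_nz : (p%:R ^+ k : rat) != 0 by rewrite expf_neq0.
have -> : (x^-1 - y^-1) / p%:R ^+ k = - (x^-1 * y^-1 * ((x - y) / p%:R ^+ k)).
  by field; rewrite x0 y0 pk_nz.
by rewrite rpredN rpredM // rpredM.
Qed.

End Congruence.

Lemma p_integralV_lt (p m : nat) : prime p -> (0 < m < p)%N -> m%:R^-1 \in p_integral p.
Proof.
move=> p_pr /andP[m0 lt_mp]; apply: p_integralV.
by rewrite prime_coprime // gtnNdvd.
Qed.

(** * The interpolation formula modulo p^4 *)

Section ParamSumCongruence.
Variables (p n : nat).
Hypotheses (p_pr : prime p) (p_eq : p = n.*2.+1) (p_gt3 : (3 < p)%N).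
Let M := n./2.
Let s (i : nat) : rat := p%:R - 2 * i%:R.
Let p_gt0 : (0 < p)%N := prime_gt0 p_pr.

Let invp (m : nat) : (0 < m < p)%N -> m%:R^-1 \in p_integral p.
Proof. exact: p_integralV_lt. Qed.

Let le_M (i : nat) : (i < M)%N -> (2 * i.+1 <= n)%N.
Proof. rewrite /M; lia. Qed.

Let pow2V m : (2 ^ m)%:R^-1 \in p_integral p.
Proof. by rewrite natrX -exprVn rpredX // invp //; lia. Qed.

Let subpE (m : nat) : (m < p)%N -> (p - m)%:R = p%:R - m%:R :> rat.
Proof. by move=> lt_mp; rewrite natrB // ltnW. Qed.

(* The factors that [m] contributes to [P (s_i ^ 2)] and to the Lagrange weight
   of the node [s_i ^ 2] at [0]. *)
Let factor i m : rat :=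
  (1 - s i ^+ 2 / (2 * m%:R) ^+ 2) * (s m ^+ 2 / (s m ^+ 2 - s i ^+ 2)).

(** Here [s 0 = p], and [factor 0 m] is [(2m-p)^3 (2m+p) / (16 m^3 (m-p))]. The numerator equals
    [16 m^3 (m-p) + p^3 (4m-p)], since the terms in [p^2] cancel. *)
Let factor0 m : (0 < m < p)%N -> p_cong p 3 (factor 0 m) 1.
Proof.
move=> /andP[m_gt0 lt_mp]; rewrite /p_cong.
have -> : (factor 0 m - 1) / p%:R ^+ 3 =
  - (4 * m%:R - p%:R) * ((2 ^ 4)%:R^-1 * m%:R^-1 ^+ 3 * (p - m)%:R^-1).
  have m_nz : (m%:R : rat) != 0 by exact: natr_neq0.
  have pm_nz : (p - m)%:R != 0 :> rat by rewrite natr_neq0 // subn_gt0.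
  have p_nz : (p%:R : rat) != 0 by exact: natr_neq0.
  move: pm_nz; rewrite subpE // /factor /s mulr0 subr0 => pm_nz.
  have -> : (p%:R - 2 * m%:R) ^+ 2 - p%:R ^+ 2 = - 4 * m%:R * (p%:R - m%:R) :> rat by ring.
  by rewrite natrX; field; rewrite p_nz m_nz pm_nz.
rewrite rpredM ?rpredN ?rpredB ?rpredM ?rpredX ?rpred_nat ?pow2V ?invp ?m_gt0 //.
lia.
Qed.

(** Modulo [p], [s m ^+ 2] is [(2m)^2], so the two fractions in [factor] are inverse to each other.
    The hypotheses make [i - m] and [p - (m + i)] units. *)
Let factorE i m : (0 < m < p)%N -> (0 < i < p)%N -> (m + i < p)%N -> m != i ->
  p_cong p 1 (factor i m) 1.
Proof.
move=> /andP[m_gt0 lt_mp] /andP[i_gt0 lt_ip] lt_mi ne_mi; rewrite /p_cong.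
have -> : (factor i m - 1) / p%:R ^+ 1 =
  s i ^+ 2 * (4 * m%:R - p%:R) *
  ((2 ^ 4)%:R^-1 * m%:R^-1 ^+ 2 * (i%:R - m%:R)^-1 * (p - (m + i))%:R^-1).
  have m_nz : (m%:R : rat) != 0 by exact: natr_neq0.
  have pm_nz : (p - (m + i))%:R != 0 :> rat by rewrite natr_neq0 // subn_gt0.
  have im_nz : (i%:R - m%:R) != 0 :> rat by rewrite subr_eq0 eqr_nat eq_sym.
  have p_nz : (p%:R : rat) != 0 by exact: natr_neq0.
  move: pm_nz; rewrite subpE // natrD /factor /s => pm_nz.
  have -> : (p%:R - 2 * m%:R) ^+ 2 - (p%:R - 2 * i%:R) ^+ 2
     = 4 * (i%:R - m%:R) * (p%:R - (m%:R + i%:R)) :> rat by ring.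
  by rewrite natrX; field; rewrite p_nz m_nz pm_nz im_nz.
have imV : (i%:R - m%:R)^-1 \in p_integral p.
  have [lt_im|lt_mi'|e] := ltngtP i m.
  - by rewrite -opprB invrN rpredN -natrB 1?ltnW // invp // subn_gt0 lt_im; lia.
  - by rewrite -natrB 1?ltnW // invp // subn_gt0 lt_mi'; lia.
  - by rewrite e eqxx in ne_mi.
rewrite /s rpredM ?rpredB ?rpredM ?rpredX ?rpredB ?rpredM ?rpred_nat ?pow2V ?invp ?m_gt0 ?imV //.
lia.
Qed.

Let denom_horner Y : (pole_poly M).[Y] = \prod_(m < M) (1 - Y / (2 * m.+1%:R) ^+ 2).
Proof.
rewrite horner_prod; apply: eq_bigr => m _.
by rewrite hornerD hornerN hornerZ hornerX -[1]/(1%:P) hornerC [_^-1 * _]mulrC.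
Qed.

(** Without [l = 0] both products run over [1..M] and pair up into [factor 0 m]; the leading
    [s 0 = p] raises the modulus from [p^3] to [p^4]. *)
Let term0 : p_cong p 4
  (s 0 * (pole_poly M).[s 0 ^+ 2]
     * \prod_(l < M.+1 | l != ord0) (s l ^+ 2 / (s l ^+ 2 - s 0 ^+ 2))) p%:R.
Proof.
rewrite denom_horner -mulrA [X in _ * (_ * X)]big_mkcond big_ord_recl /= mul1r.
rewrite -big_split /= {1}/s mulr0 subr0 -[p%:R in X in p_cong _ _ _ X]mulr1 -[p%:R]expr1.
apply: (p_cong_scale p_gt0 1 (k := 3)); apply: p_cong_prod1 => // m _.
apply: factor0; have := le_M (ltn_ord m); rewrite p_eq; lia.
Qed.

(** Two factors stay unpaired: the one of [pole_poly] with [m = j], divisible by [p], and the weight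
    with [l = 0], divisible by [p^2]. All the rest is then needed only modulo [p]. *)
Let termS (i : 'I_M) : p_cong p 4
  (s i.+1 * (pole_poly M).[s i.+1 ^+ 2]
     * \prod_(l < M.+1 | l != lift ord0 i) (s l ^+ 2 / (s l ^+ 2 - s i.+1 ^+ 2)))
  (p%:R ^+ 3 * ((2 * i.+1%:R ^+ 2)^-1)).
Proof.
have le_i := le_M (ltn_ord i); set j := i.+1.
have lt_jp : (2 * j < p)%N by rewrite p_eq /j; lia.
rewrite denom_horner -mulrA [X in _ * (_ * X)]big_mkcond big_ord_recl /=.
rewrite (bigD1 i) //= [X in _ * (_ * (_ * X))](bigD1 i) //= eqxx /= mul1r.
rewrite [X in _ * (_ * (_ * X))](eq_bigr
  (fun l : 'I_M => s l.+1 ^+ 2 / (s l.+1 ^+ 2 - s j ^+ 2))); last first.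
  by move=> l ne_li; rewrite (inj_eq lift_inj) ne_li.
rewrite -/j; set X := \prod_(l < M | l != i) (1 - _).
set Y := \prod_(l < M | l != i) _.
have XY1 : p_cong p 1 (X * Y) 1.
  rewrite -big_split /=; apply: p_cong_prod1 => // l ne_li.
  have le_l := le_M (ltn_ord l).
  apply: factorE; rewrite ?p_eq /j ?eqSS //; lia.
have j_nz : (j%:R : rat) != 0 by exact: natr_neq0.
have lt_jp' : (j < p)%N by lia.
have pj_nz : (p%:R - j%:R : rat) != 0 by rewrite -subpE // natr_neq0 // subn_gt0.
have jV : j%:R^-1 \in p_integral p by rewrite invp // lt_jp'.
have pjV : (p%:R - j%:R)^-1 \in p_integral p.
  by rewrite -subpE // invp // subn_gt0 lt_jp' /j; lia.
have -> : s j * ((1 - s j ^+ 2 / (2 * j%:R) ^+ 2) * X * (s 0 ^+ 2 / (s 0 ^+ 2 - s j ^+ 2) * Y))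
  = p%:R ^+ 3 * ((p%:R - 2 * j%:R) * (4 * j%:R - p%:R) *
        ((2 ^ 4)%:R^-1 * j%:R^-1 ^+ 3 * (p%:R - j%:R)^-1) * (X * Y)).
  rewrite /s mulr0 subr0.
  have -> : p%:R ^+ 2 - (p%:R - 2 * j%:R) ^+ 2 = 4 * j%:R * (p%:R - j%:R) :> rat by ring.
  by rewrite natrX; field; rewrite j_nz pj_nz.
apply: (p_cong_scale p_gt0 3 (k := 1)).
rewrite -[X in p_cong _ _ _ X]mulr1; apply: p_congM => //.
- by rewrite invfM -exprVn rpredM ?rpredX // (pow2V 1).
- by rewrite (p_cong_integral _ XY1) ?rpred1.
have p_nz : (p%:R : rat) != 0 by exact: natr_neq0.
rewrite /p_cong.
have -> : ((p%:R - 2 * j%:R) * (4 * j%:R - p%:R) *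
     ((2 ^ 4)%:R^-1 * j%:R^-1 ^+ 3 * (p%:R - j%:R)^-1) - (2 * j%:R ^+ 2)^-1) / p%:R ^+ 1
  = - (p%:R + 2 * j%:R) * ((2 ^ 4)%:R^-1 * j%:R^-1 ^+ 3 * (p%:R - j%:R)^-1) :> rat.
  by rewrite natrX; field; rewrite p_nz j_nz pj_nz.
by rewrite rpredM ?rpredN ?rpredD ?rpredM ?rpredX ?rpred_nat.
Qed.

Lemma param_sum0_cong : p_cong p 4 (param_sum n 0)
  (p%:R + p%:R ^+ 3 * \sum_(i < n./2) (2 * i.+1%:R ^+ 2)^-1).
Proof.
rewrite param_sum_lagrange -p_eq -/M big_ord_recl mulr_sumr.
apply: p_congD.
  exact: term0.
by apply: p_cong_sum => i _; rewrite lift0; apply: termS.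
Qed.

End ParamSumCongruence.

(** * Euler numbers modulo p *)

(* The value at [(X + c)^N] of the linear functional sending [X^k] to [E k]. *)
Definition umbral (E : nat -> rat) (N : nat) (c : rat) : rat :=
  \sum_(k < N.+1) 'C(N, k)%:R * c ^+ (N - k) * E k.

(** This compares coefficients in [F(x) (e^(2x) + 1) = 2 e^x], where [F] is the exponential
    generating function. *)
Definition euler_rec (E : nat -> rat) : Prop := forall m, E m + umbral E m 2 = 2.

(** By [euler_rec] the functional [L] maps [(X+2)^i + X^i] to [2]. Expanding [(X+c+2)^N + (X+c)^N]
    in powers of [c] then gives a binomial sum. *)
Lemma umbral_step (E : nat -> rat) (N : nat) (c : rat) : euler_rec E ->
  umbral E N (c + 2) + umbral E N c = 2 * (c + 1) ^+ N.
Proof.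
move=> recE.
pose L (q : {poly rat}) : rat := \sum_(k < N.+1) q`_k * E k.
have L_sum (F : 'I_N.+1 -> {poly rat}) : L (\sum_i F i) = \sum_i L (F i).
  by rewrite /L exchange_big /=; apply: eq_bigr => k _; rewrite coef_sum mulr_suml.
have L_scale a q : L (a *: q) = a * L q.
  by rewrite /L mulr_sumr; apply: eq_bigr => k _; rewrite coefZ mulrA.
have coef_pow a m k : (('X + a%:P) ^+ m)`_k = 'C(m, k)%:R * a ^+ (m - k) :> rat.
  have [le_km|lt_mk] := leqP k m; last first.
    rewrite bin_small // mul0r nth_default // (leq_trans (size_poly_exp_leq _ _)) //.
    by rewrite size_XaddC mul1n.
  rewrite addrC exprDn coef_sum (bigD1 (Ordinal (le_km : (k < m.+1)%N))) //=.
  rewrite coefMn -rmorphXn coefCM coefXn eqxx mulr1 big1 ?addr0 ?mulr_natl // => i ne_ik.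
  rewrite coefMn -rmorphXn coefCM coefXn.
  case: eqP => [e|_]; last by rewrite mulr0 mul0rn.
  by rewrite -val_eqE /= -e eqxx in ne_ik.
have L_pow a m : (m <= N)%N -> L (('X + a%:P) ^+ m) = umbral E m a.
  move=> le_mN; rewrite /L -(big_mkord xpredT (fun k => (('X + a%:P) ^+ m)`_k * E k)).
  rewrite (@big_cat_nat _ _ _ m.+1) //= [X in _ + X]big1_seq ?addr0 => [|k].
    by rewrite big_mkord; apply: eq_bigr => k _; rewrite coef_pow.
  by rewrite mem_index_iota /= coef_pow => /andP[lt_mk _]; rewrite bin_small // !mul0r.
have expand a : umbral E N (c + a) = \sum_(i < N.+1) ('C(N, i)%:R * c ^+ (N - i)) * umbral E i a.
  rewrite -L_pow // polyCD addrCA exprDn L_sum; apply: eq_bigr => i _.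
  rewrite -L_pow; last by rewrite -ltnS.
  by rewrite -L_scale -mulrnAl -rmorphXn -rmorphMn /= mul_polyC mulr_natl.
rewrite expand -[in X in _ + X](addr0 c) expand -big_split /= exprDn mulr_sumr.
apply: eq_bigr => i _; rewrite -mulrDr expr1n mulr1.
have -> : umbral E i 0 = E i.
  rewrite /umbral big_ord_recr /= subnn binn !mul1r big1 ?add0r // => k _.
  by rewrite expr0n subn_eq0 leqNgt ltn_ord mulr0 mul0r.
by rewrite [_ + E i]addrC recE mulr_natl mulrC.
Qed.

Lemma umbral0 (E : nat -> rat) (N : nat) : umbral E N 0 = E N.
Proof.
rewrite /umbral big_ord_recr /= subnn binn !mul1r big1 ?add0r // => k _.
by rewrite expr0n subn_eq0 leqNgt ltn_ord mulr0 mul0r.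
Qed.

(** This is the alternating sum of [umbral_step] over [c = 0, 2, ..., 2(m-1)]. *)
Lemma umbral_even (E : nat -> rat) (N m : nat) : euler_rec E ->
  (-1) ^+ m * umbral E N (2 * m%:R) =
  E N - 2 * \sum_(j < m) (-1) ^+ j * (2 * j%:R + 1) ^+ N.
Proof.
move=> recE; elim: m => [|m IH].
  by rewrite big_ord0 !mulr0 subr0 mul1r umbral0.
rewrite big_ord_recr /= mulrDr opprD addrA -IH -[m.+1%:R]natr1 mulrDr mulr1.
by rewrite mulrCA -(umbral_step _ _ recE) exprS; ring.
Qed.

Section EulerCongruence.
Variables (E : nat -> rat) (p n : nat).
Hypotheses (recE : euler_rec E).
Hypotheses (p_pr : prime p) (p_eq : p = n.*2.+1) (p_gt3 : (3 < p)%N).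
Let p_gt0 : (0 < p)%N := prime_gt0 p_pr.

Let two_V : (2 : rat)^-1 \in p_integral p.
Proof. by rewrite p_integralV_lt //; lia. Qed.

(** The recurrence expresses [2 E m] through earlier values, and [2] is a unit modulo [p]. *)
Lemma euler_integral (m : nat) : E m \in p_integral p.
Proof.
elim/ltn_ind: m => m IH.
have := recE m; rewrite /umbral big_ord_recr /= subnn binn !mul1r => e.
have -> : E m = 2^-1 * (2 - \sum_(i < m) 'C(m, i)%:R * 2 ^+ (m - i) * E i).
  by rewrite -[X in X - _]e; field.
rewrite rpredM // rpredB ?rpred_nat // rpred_sum // => i _.
by rewrite rpredM ?rpredM ?rpredX ?rpred_nat ?IH.
Qed.

(** Take [m = p] in [umbral_even]: the sign is [-1], and [umbral E N (2p)] is [E N] modulo [p], so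
    [2 E N] is twice the power sum. *)
Lemma euler_power_sum (N : nat) :
  p_cong p 1 (E N) (\sum_(j < n.*2.+1) (-1) ^+ j * (2 * j%:R + 1) ^+ N).
Proof.
have c : p_cong p 1 (umbral E N (2 * p%:R)) (E N).
  rewrite /umbral big_ord_recr /= subnn binn !mul1r -[X in p_cong _ _ _ X]add0r.
  apply: p_congD; last exact: p_cong_refl.
  rewrite [X in p_cong _ _ _ X](_ : 0 = \sum_(i < N) 0); last by rewrite big1.
  apply: p_cong_sum => k _.
  have -> : (N - k = (N - k).-1.+1)%N by rewrite prednK // subn_gt0.
  rewrite exprS.
  have -> x y : 'C(N, k)%:R * (2 * p%:R * x) * y = p%:R ^+ 1 * ('C(N, k)%:R * 2 * x * y) :> rat.
    by ring.
  apply: p_cong_divisible => //.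
  by rewrite !rpredM ?rpredX ?rpredM ?rpred_nat ?euler_integral.
have := umbral_even N n.*2.+1 recE; rewrite -signr_odd /= odd_double -p_eq expr1 mulN1r => e.
have -> : \sum_(j < p) (-1) ^+ j * (2 * j%:R + 1) ^+ N = 2^-1 * (E N + umbral E N (2 * p%:R)).
  by rewrite -[umbral _ _ _]opprK e; field.
have {1}-> : E N = 2^-1 * (E N + E N) by field.
by apply/p_congMl/p_congD => //; [exact: p_cong_refl|exact: p_cong_sym].
Qed.

Lemma fermat_cong (a : nat) : coprime p a -> p_cong p 1 (a%:R ^+ p.-1) 1.
Proof.
move=> cop; have := fermat_little a p_pr.
rewrite -{1}(prednK p_gt0) expnS -[X in _ = X %[mod p]]muln1 => /eqP.
have a_gt0 : (0 < a)%N.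
  by case: (a) cop => //; rewrite /coprime gcdn0 => /eqP e; move: p_gt3; rewrite e.
rewrite eqn_mod_dvd ?leq_mul2l ?expn_gt0 ?a_gt0 ?orbT //.
rewrite -mulnBr Gauss_dvdr // => /dvdnP[q e].
apply/p_congP => //; exists q%:R; first exact: rpred_nat.
rewrite expr1 -natrM mulnC -e natrB ?expn_gt0 ?a_gt0 //.
by rewrite natrX addrC subrK.
Qed.

Lemma inv_pow_cong (a : nat) : (0 < a < p)%N -> p_cong p 1 (a%:R ^+ (p - 3)) (a%:R ^- 2).
Proof.
move=> /andP[a_gt0 lt_ap]; have a_nz := natr_neq0 a_gt0.
have -> : a%:R ^+ (p - 3) = a%:R ^- 2 * a%:R ^+ p.-1 :> rat.
  have -> : (p.-1 = 2 + (p - 3))%N by lia.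
  by rewrite exprD mulKf // expf_neq0.
rewrite -[X in p_cong _ _ _ X]mulr1; apply: p_congMl.
  by rewrite -exprVn rpredX // p_integralV_lt ?a_gt0.
by rewrite fermat_cong // prime_coprime // gtnNdvd.
Qed.

(** The centre [j = n] is the index with [2j+1 = p], and indices symmetric about it give the bases
    [p - 2(i+1)] and [p + 2(i+1)]. *)
Lemma sum_symmetric (F : nat -> rat) :
  \sum_(j < n.*2.+1) F j = F n + \sum_(i < n) (F (n - i.+1)%N + F (n + i.+1)%N).
Proof.
rewrite -addnn -addnS big_split_ord big_ord_recl /= addn0 addrCA big_split /=; congr (_ + (_ + _)).
by rewrite (reindex_inj rev_ord_inj).
Qed.

(** The central power is divisible by [p]. As [p - 3] is even, both members of a pair reduce to
    [(2(i+1))^(p-3)], which is [(2(i+1))^-2] by Fermat. *)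
Lemma euler_alternating :
  p_cong p 1 (E (p - 3)%N) ((-1) ^+ n * (2^-1 * \sum_(i < n) (-1) ^+ i.+1 * i.+1%:R ^- 2)).
Proof.
apply: p_cong_trans (euler_power_sum (p - 3)) _.
rewrite (sum_symmetric (fun j => (-1) ^+ j * (2 * j%:R + 1) ^+ (p - 3))).
rewrite -[X in p_cong _ _ _ X]add0r.
have e_pn : 2 * n%:R + 1 = p%:R :> rat by rewrite p_eq -[RHS]natr1 -mul2n natrM.
apply: p_congD.
  rewrite e_pn; have -> : (p - 3 = (p - 4).+1)%N by lia.
  have -> x : (-1) ^+ n * p%:R ^+ x.+1 = p%:R ^+ 1 * ((-1) ^+ n * p%:R ^+ x) :> rat.
    by rewrite exprS; ring.
  by rewrite p_cong_divisible // rpredM ?rpredX ?rpredN ?rpred1 ?rpred_nat.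
rewrite !mulr_sumr; apply: p_cong_sum => i _.
have lt_i : (2 * i.+1 < p)%N by have := ltn_ord i; rewrite p_eq; lia.
have -> : 2 * (n - i.+1)%N%:R + 1 = p%:R - (2 * i.+1)%:R :> rat.
  by rewrite natrB // -e_pn natrM; ring.
have -> : 2 * (n + i.+1)%N%:R + 1 = p%:R + (2 * i.+1)%:R :> rat.
  by rewrite natrD -e_pn natrM; ring.
have -> : (-1) ^+ (n - i.+1) = (-1) ^+ n * (-1) ^+ i.+1 :> rat.
  by rewrite -signr_odd oddB // signr_addb !signr_odd.
rewrite exprD -mulrDr -mulrA; apply: p_congMl.
  by rewrite rpredX // rpredN rpred1.
rewrite mulrCA; apply: p_congMl.
  by rewrite rpredX // rpredN rpred1.
have pow_even (x : rat) : p_cong p 1 x (2 * i.+1)%:R \/ p_cong p 1 x (- (2 * i.+1)%:R) ->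
    p_cong p 1 (x ^+ (p - 3)) ((2 * i.+1)%:R ^- 2).
  move=> h; apply: p_cong_trans (inv_pow_cong _); last by rewrite lt_i andbT.
  case: h => h; first by rewrite p_congX // rpred_nat.
  have -> : (2 * i.+1)%:R ^+ (p - 3) = (- (2 * i.+1)%:R) ^+ (p - 3) :> rat.
    have odd_p3 : odd (p - 3) = false by move: p_eq p_gt3; lia.
    by rewrite [RHS]exprNn -signr_odd odd_p3 mul1r.
  by rewrite p_congX // rpredN rpred_nat.
have -> : 2^-1 * i.+1%:R ^- 2 = (2 * i.+1)%:R ^- 2 + (2 * i.+1)%:R ^- 2 :> rat.
  by rewrite natrM; field; rewrite -mulrS natr_neq0.
have p_cong0 : p_cong p 1 (p%:R : rat) 0.
  by rewrite -[p%:R]expr1 -[_ ^+ 1]mulr1 p_cong_divisible // rpred1.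
apply: p_congD; apply: pow_even; [right|left].
  by rewrite -[X in p_cong _ _ _ X]add0r p_congD // p_cong_refl.
by rewrite -[X in p_cong _ _ _ X]add0r p_congD // p_cong_refl.
Qed.

(** The alternating sum is twice the sum over even indices minus the full sum, and
    [2 / (2k)^2 = 1 / (2 k^2)]. *)
Lemma alternating_inv_squares (m : nat) :
  \sum_(i < m) (-1) ^+ i.+1 * i.+1%:R ^- 2 =
  2^-1 * (\sum_(i < m./2) i.+1%:R ^- 2) - \sum_(i < m) i.+1%:R ^- 2 :> rat.
Proof.
elim: m => [|m IH]; first by rewrite !big_ord0 mulr0 subr0.
rewrite [LHS]big_ord_recr [in X in _ - X]big_ord_recr /= IH -signr_odd /=.
rewrite uphalf_half; case: (boolP (odd m)) => [odd_m|even_m].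
  rewrite add1n big_ord_recr /= expr0.
  have -> : m.+1%:R = 2 * m./2.+1%:R :> rat by rewrite -natrM; congr _%:R; lia.
  by rewrite !invfM; field; rewrite -mulrS natr_neq0.
by rewrite add0n expr1; ring.
Qed.

(* Splitting [1..p-1] at the middle gives [2 H], splitting it by parity [H / 2]. *)
Lemma sum_inv_squares : p_cong p 1 (\sum_(i < n) (i.+1%:R : rat) ^- 2) 0.
Proof.
set H := \sum_(i < n) _.
have invp_reflect (a b : nat) : (a + b = p)%N -> (0 < a)%N -> (0 < b)%N ->
    p_cong p 1 ((a%:R : rat) ^- 2) (b%:R ^- 2).
  move=> e a0 b0; have := natr_neq0 a0; have := natr_neq0 b0 => bz az.
  apply: p_congV => //; rewrite ?expf_neq0 // -?exprVn ?rpredX ?p_integralV_lt // ?a0 ?b0; try lia.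
  have -> : b%:R ^+ 2 = (- b%:R) ^+ 2 :> rat by rewrite sqrrN.
  apply: p_congX => //; first by rewrite rpredN rpred_nat.
  by rewrite /p_cong opprK -natrD e expr1 divff ?rpred1 // natr_neq0.
have all_squares : p_cong p 1 (\sum_(i < n.*2) (i.+1%:R : rat) ^- 2) (H + H).
  rewrite -addnn big_split_ord /=; apply: p_congD; first exact: p_cong_refl.
  rewrite /H (reindex_inj rev_ord_inj); apply: p_cong_sum => i _ /=.
  by apply: invp_reflect; have := ltn_ord i; rewrite ?p_eq //; lia.
have by_parity : p_cong p 1 (\sum_(i < n.*2) (i.+1%:R : rat) ^- 2) (4^-1 * H + 4^-1 * H).
  have -> : \sum_(i < n.*2) (i.+1%:R : rat) ^- 2 =
     \sum_(i < n) ((2 * i.+1)%:R : rat) ^- 2 + \sum_(i < n) ((2 * i).+1%:R : rat) ^- 2.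
    elim: (n) => [|m IH]; first by rewrite !big_ord0 addr0.
    rewrite doubleS !big_ord_recr /= IH -mul2n.
    have -> : (2 * m.+1 = (2 * m).+2)%N by lia.
    ring.
  have quarter : \sum_(i < n) ((2 * i.+1)%:R : rat) ^- 2 = 4^-1 * H.
    rewrite /H mulr_sumr; apply: eq_bigr => i _; rewrite natrM.
    by field; rewrite -mulrS natr_neq0.
  rewrite quarter; apply: p_congD; first exact: p_cong_refl.
  (* Reversing the order pairs each odd number below [p] with an even number, the two adding up to
     [p]. *)
  rewrite -quarter (reindex_inj rev_ord_inj); apply: p_cong_sum => i _ /=.
  by apply: invp_reflect; have := ltn_ord i; rewrite ?p_eq //; lia.
have := p_congD all_squares (p_congN by_parity).
(* The two evaluations differ by [3/2 * H], and [3] is a unit because [p > 3]. *)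
have -> : H + H - (4^-1 * H + 4^-1 * H) = 3 * 2^-1 * H by field.
rewrite subrr => h.
have -> : H = (2 * 3^-1) * (3 * 2^-1 * H) by field.
rewrite -[X in p_cong _ _ _ X](mulr0 (2 * 3^-1)); apply: p_congMl; last exact: p_cong_sym.
by rewrite rpredM ?rpred_nat // p_integralV_lt.
Qed.

(** By [sum_inv_squares] only the sum up to [n./2] survives in [alternating_inv_squares]. *)
Lemma quarter_sum_euler :
  p_cong p 1 (\sum_(i < n./2) (2 * i.+1%:R ^+ 2 : rat)^-1) (2 * (-1) ^+ n * E (p - 3)%N).
Proof.
have c := euler_alternating.
have -> : \sum_(i < n./2) (2 * i.+1%:R ^+ 2)^-1 =
   2 * (-1) ^+ n * ((-1) ^+ n * (2^-1 * (2^-1 * \sum_(i < n./2) i.+1%:R ^- 2))) :> rat.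
  have split_sign (x S : rat) : 2 * x * (x * (2^-1 * (2^-1 * S))) = x ^+ 2 * (2^-1 * S).
    by field.
  rewrite split_sign sqrr_sign mul1r mulr_sumr.
  by apply: eq_bigr => i _; rewrite invfM.
apply: p_congMl; first by rewrite rpredM ?rpred_nat ?rpredX ?rpredN ?rpred1.
apply: p_cong_sym; apply: p_cong_trans c _; rewrite alternating_inv_squares.
apply: p_congMl; first by rewrite rpredX ?rpredN ?rpred1.
apply: p_congMl => //.
rewrite -[X in p_cong _ _ _ X]subr0; apply: p_congD; first exact: p_cong_refl.
exact/p_congN/sum_inv_squares.
Qed.

End EulerCongruence.

(** * The sum of the theorem *)

(** This is [(1/2)_k / k!]. *)
Definition half_ratio (k : nat) : rat := \prod_(i < k) ((2 * i%:R + 1) / (2 * i.+1%:R)).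

Lemma half_ratioS (k : nat) :
  half_ratio k.+1 = half_ratio k * ((2 * k%:R + 1) / (2 * k.+1%:R)).
Proof. by rewrite /half_ratio big_ord_recr. Qed.

Lemma pochhammer_half (k : nat) : pochhammer (1 / 2) k = half_ratio k * k`!%:R.
Proof.
elim: k => [|k IH]; first by rewrite /pochhammer /half_ratio !big_ord0 mulr1.
rewrite /pochhammer big_ord_recr -/(pochhammer _ _) /= IH half_ratioS factS natrM.
by field; rewrite -mulrS pnatr_eq0.
Qed.

Lemma two_kB1_neq0 (k : nat) : 2 * k%:R - 1 != 0 :> rat.
Proof. by rewrite subr_eq0 -natrM (eqr_nat _ _ 1); lia. Qed.

(** Shifting the parameter by one affects only the end factors:
    [(k - 1/2) (-1/2)_k = (-1/2) (1/2)_k]. *)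
Lemma pochhammer_neg_half (k : nat) :
  pochhammer (- (1 / 2)) k = - (half_ratio k * k`!%:R) / (2 * k%:R - 1).
Proof.
rewrite -pochhammer_half; elim: k => [|k IH].
  by rewrite /pochhammer !big_ord0; field.
rewrite /pochhammer !big_ord_recr -!/(pochhammer _ _) /= IH.
have := two_kB1_neq0 k; have := two_kB1_neq0 k.+1; rewrite -natr1 => h1 h2.
by field; rewrite h2; apply/andP; split=> //; apply: contra h1 => /eqP<-; apply/eqP; ring.
Qed.

Lemma central_bin_half_ratio (k : nat) : 'C(k.*2, k)%:R = 4 ^+ k * half_ratio k.
Proof.
elim: k => [|k IH]; first by rewrite /half_ratio big_ord0 bin0 mulr1.
apply: (mulfI (natS_neq0 k)); rewrite central_binS IH half_ratioS exprS.
by field; rewrite -mulrS pnatr_eq0.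
Qed.

(** The hypergeometric term common to both sums: [param_sum n 0] weights it by [3k+1], the sum of
    the theorem by [(3k-1) / (2k-1)^2]. *)
Definition ramanujan_weight (k : nat) : rat := 4 ^+ k * half_ratio k ^+ 3.

Lemma ramanujan_weightS (k : nat) : ramanujan_weight k.+1 =
  ramanujan_weight k * ((2 * k%:R + 1) ^+ 3 / (2 * k.+1%:R ^+ 3)).
Proof.
rewrite /ramanujan_weight half_ratioS exprS.
by field; rewrite -mulrS pnatr_eq0.
Qed.

Lemma param_sum0E (n : nat) :
  param_sum n 0 = \sum_(k < n.+1) (3 * k%:R + 1) * ramanujan_weight k.
Proof.
apply: eq_bigr => k _; rewrite -mulrA central_bin_half_ratio; congr (_ * _).
rewrite /ramanujan_weight -mulrA; congr (_ * _); rewrite exprS; congr (_ * _).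
rewrite /half_ratio -prodrXl; apply: eq_bigr => i _; rewrite /param_factor !subr0.
by field; rewrite -mulrS pnatr_eq0.
Qed.

(* Gosper: with [u_k] the weight, [(3k+1) u_k - (3k-1) u_k / (2k-1)^2] is the
   forward difference of [4 k^3 u_k / (2k-1)^2]. *)
Lemma sum_shifted (N : nat) :
  \sum_(k < N.+1) (3 * k%:R - 1) *
       (pochhammer (- (1 / 2)) k ^+ 2 * pochhammer (1 / 2) k * 4 ^+ k / k`!%:R ^+ 3)
  = \sum_(k < N.+1) (3 * k%:R + 1) * ramanujan_weight k
    - 2 * (2 * N%:R + 1) * ramanujan_weight N.
Proof.
have termE k : (3 * k%:R - 1) *
       (pochhammer (- (1 / 2)) k ^+ 2 * pochhammer (1 / 2) k * 4 ^+ k / k`!%:R ^+ 3)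
    = (3 * k%:R - 1) / (2 * k%:R - 1) ^+ 2 * ramanujan_weight k.
  rewrite pochhammer_half pochhammer_neg_half /ramanujan_weight.
  by field; rewrite fact_neq0 two_kB1_neq0.
rewrite (eq_bigr (fun k : 'I_N.+1 => (3 * k%:R - 1) / (2 * k%:R - 1) ^+ 2 * ramanujan_weight k)) //.
elim: N => [|N IH].
  by rewrite !big_ord1 /ramanujan_weight /half_ratio big_ord0 /=; field.
rewrite big_ord_recr [in RHS]big_ord_recr /= IH ramanujan_weightS -[N.+1%:R]natr1.
field; rewrite natS_neq0 /=.
have -> : 2 * (N%:R + 1) - 1 = N.*2.+1%:R :> rat.
  by rewrite -[RHS]natr1 -mul2n natrM; ring.
by rewrite pnatr_eq0.
Qed.

(** * The boundary term and the Legendre symbol of [-1] *)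

Section Prime.
Variables (p n : nat).
Hypotheses (p_pr : prime p) (p_eq : p = n.*2.+1) (p_gt3 : (3 < p)%N).
Let p_gt0 : (0 < p)%N := prime_gt0 p_pr.

Let sgn_prod : (-1) ^+ n = \prod_(i < n) (-1) :> rat.
Proof. by rewrite prodr_const card_ord. Qed.

(** Read backwards, the odd numerators are [p - 2(i+1)], to be divided by [2(i+1)]. *)
Lemma half_ratio_cong : p_cong p 1 (half_ratio n) ((-1) ^+ n).
Proof.
have -> : half_ratio n = (-1) ^+ n * \prod_(i < n) (1 - p%:R / (2 * i.+1)%:R).
  have -> : half_ratio n = \prod_(i < n) (2 * (n - i.+1)%:R + 1) / \prod_(i < n) (2 * i.+1)%:R.
    rewrite /half_ratio [X in X / _](reindex_inj rev_ord_inj) -prodf_div /=.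
    apply: eq_bigr => i _; rewrite natrM; congr ((2 * _%:R + 1) / _).
    by have := ltn_ord i; lia.
  rewrite sgn_prod -big_split -prodf_div /=; apply: eq_bigr => i _.
  rewrite natrB ?ltn_ord // p_eq -[n.*2.+1%:R]natr1 -mul2n !natrM.
  by field; rewrite -mulrS natr_neq0.
rewrite -[X in p_cong _ _ _ X]mulr1; apply: p_congMl.
  by rewrite rpredX // rpredN rpred1.
apply: p_cong_prod1 => // i _.
have -> : 1 - p%:R / (2 * i.+1)%:R = 1 + p%:R ^+ 1 * - (2 * i.+1)%:R^-1 :> rat.
  by rewrite expr1 mulrN.
apply/p_congP => //; exists (- (2 * i.+1)%:R^-1) => //.
by rewrite rpredN p_integralV_lt //; have := ltn_ord i; rewrite p_eq; lia.
Qed.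

(** Here [4^n = 2^(p-1)] is [1] by Fermat, and a sign equals its cube. *)
Lemma ramanujan_weight_cong : p_cong p 1 (ramanujan_weight n) ((-1) ^+ n).
Proof.
have sgn_int m : ((-1) ^+ m : rat) \in p_integral p by rewrite rpredX // rpredN rpred1.
have -> : (-1) ^+ n = 1 * ((-1) ^+ n) ^+ 3 :> rat.
  by rewrite exprS sqrr_sign !mulr1 mul1r.
have c3 := p_congX p_gt0 3 (sgn_int n) half_ratio_cong.
apply: p_congM => //; rewrite ?rpred1 //.
  by rewrite (p_cong_integral p_gt0 c3) // rpredX.
have -> : 4 ^+ n = 2%:R ^+ p.-1 :> rat by rewrite p_eq /= -mul2n exprM -natrX.
by rewrite fermat_cong // prime_coprime // gtnNdvd //; lia.
Qed.

(** The sum of the theorem runs one index past [param_sum n], so its last summand joins the Gosper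
    term. The weight at [n+1] contains [(2n+1)^3 = p^3], and the cofactor matters only modulo
    [p]. *)
Lemma boundary_cong : p_cong p 4
  ((3 * n.+1%:R + 1) * ramanujan_weight n.+1 - 2 * (2 * n.+1%:R + 1) * ramanujan_weight n.+1)
  (- (6 * p%:R ^+ 3 * (-1) ^+ n)).
Proof.
have nE : (n%:R : rat) = (p%:R - 1) / 2.
  by rewrite p_eq -[n.*2.+1%:R]natr1 -mul2n natrM; field.
have p1_nz : (p%:R + 1 : rat) != 0 by exact: natS_neq0.
have -> : (3 * n.+1%:R + 1) * ramanujan_weight n.+1 -
    2 * (2 * n.+1%:R + 1) * ramanujan_weight n.+1
  = p%:R ^+ 3 * - (2 * (p%:R + 3) / (p%:R + 1) ^+ 3 * ramanujan_weight n) :> rat.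
  rewrite ramanujan_weightS -[n.+1%:R]natr1 nE; field.
  by rewrite p1_nz.
have -> : - (6 * p%:R ^+ 3 * (-1) ^+ n) = p%:R ^+ 3 * - (6 * (-1) ^+ n) :> rat by ring.
apply: (p_cong_scale p_gt0 3 (k := 1)); apply: p_congN.
apply: p_congM; rewrite ?rpred_nat //; last exact: ramanujan_weight_cong.
  by rewrite (p_cong_integral p_gt0 ramanujan_weight_cong) // rpredX // rpredN rpred1.
(* The witness comes from [2(p+3) - 6(p+1)^3 = p (2 - 6(p^2 + 3p + 3))]. *)
apply/p_congP => //; exists ((2 - 6 * (p%:R ^+ 2 + 3 * p%:R + 3)) * (p.+1%:R^-1) ^+ 3).
  rewrite rpredM ?rpredX ?rpredB ?rpredM ?rpredD ?rpredX ?rpredM ?rpred_nat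
    ?rpred1 ?p_integralV ?coprimenS //.
by rewrite -natr1; field; rewrite addrC.
Qed.

Lemma p_inv_not_integral : (p%:R : rat)^-1 \notin p_integral p.
Proof.
rewrite /in_mem /= /p_integral -[p%:R]/(p%:Z%:~R) denqVz; last by rewrite -lt0n.
by rewrite /coprime /= gcdnn neq_ltn prime_gt1 ?orbT.
Qed.

Lemma p_cong_dvdn (m : nat) : p_cong p 1 (m%:R) 0 -> (p %| m)%N.
Proof.
rewrite /p_cong subr0 expr1 => h; apply/negPn/negP; rewrite -prime_coprime // => cop.
have m_nz : (m%:R : rat) != 0.
  rewrite natr_neq0 // lt0n; apply/negP => /eqP e.
  by move: cop p_gt3; rewrite e /coprime gcdn0 => /eqP->.
have := rpredM h (p_integralV cop); rewrite mulrAC divff // mul1r.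
by apply/negP; exact: p_inv_not_integral.
Qed.

(** Wilson's theorem, with the upper half of [(p-1)!] replaced by the negatives of the lower half.
    For even [n] it makes [n!] a square root of [-1]. *)
Lemma factorial_square_cong : p_cong p 1 ((-1) ^+ n * n`!%:R ^+ 2) (- 1).
Proof.
apply: p_cong_trans (_ : p_cong p 1 ((p.-1)`!%:R) _).
  apply: p_cong_sym.
  have fE m : (m`!%:R : rat) = \prod_(i < m) i.+1%:R.
    by rewrite fact_prod natr_prod big_add1 big_mkord.
  have -> : p.-1 = (n + n)%N by rewrite p_eq addnn.
  rewrite !fE big_split_ord /= expr2 mulrCA.
  apply: p_congMl; first by rewrite rpred_prod // => i _; rewrite rpred_nat.
  rewrite (reindex_inj rev_ord_inj) /=.
  have -> : \prod_(i < n) (n + (n - i.+1)).+1%:R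
     = \prod_(i < n) i.+1%:R * ((-1) ^+ n * \prod_(i < n) (1 - p%:R / i.+1%:R)) :> rat.
    rewrite sgn_prod -!big_split /=; apply: eq_bigr => i _.
    have -> : (n + (n - i.+1)).+1%:R = p%:R - i.+1%:R :> rat.
      by rewrite -natrB; [congr _%:R|]; have := ltn_ord i; rewrite p_eq; lia.
    by field; rewrite -mulrS natr_neq0.
  rewrite mulrCA; apply: p_congMl; first by rewrite rpredX // rpredN rpred1.
  rewrite -[X in p_cong _ _ _ X]mulr1.
  apply: p_congMl; first by rewrite rpred_prod // => i _; rewrite rpred_nat.
  apply: p_cong_prod1 => // i _; apply/p_congP => //.
  exists (- i.+1%:R^-1); last by rewrite expr1 mulrN.
  by rewrite rpredN p_integralV_lt //; have := ltn_ord i; rewrite p_eq; lia.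
have := p_pr; rewrite Wilson ?prime_gt1 // => /dvdnP[q e].
apply/p_congP => //; exists q%:R; first exact: rpred_nat.
by rewrite expr1 -natrM mulnC -e -natr1; ring.
Qed.

(** If [x^2] is [-1] and [n] is odd, Fermat gives [1 = (x^2)^n = -1] modulo [p]. If [n] is even,
    [n!] is a root by [factorial_square_cong]. *)
Lemma legendreN1 : legendre (-1) p = (-1) ^+ n.
Proof.
rewrite /legendre dvdzE abszN1 dvdn1.
rewrite gtn_eqF ?prime_gt1 // -signr_odd.
case: existsP => [[x]|no_root].
  rewrite eqz_mod_dvd opprK => /dvdzP[q e].
  have x2 : p_cong p 1 (x%:R ^+ 2) (-1).
    apply/p_congP => //; exists (q%:~R).
      by apply/p_integralP; exists q, 1%N; rewrite divr1 coprimen1.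
    apply: (addIr 1); rewrite expr1 mulrC addrAC addNr add0r.
    by have := congr1 (fun z : int => z%:~R : rat) e; rewrite rmorphD rmorphXn rmorphM /=.
  case: (boolP (odd n)) => // odd_n.
  have cop : coprime p x.
    rewrite prime_coprime //; apply/negP => p_x.
    have : ((p%:Z : int) %| (x%:Z ^+ 2 + 1) - x%:Z ^+ 2)%Z.
      by rewrite rpredB //; [rewrite e dvdz_mull|rewrite dvdz_exp].
    by rewrite addrAC subrr add0r dvdzE /= dvdn1 gtn_eqF ?prime_gt1.
  have xp : p_cong p 1 ((x%:R ^+ 2) ^+ n) ((-1) ^+ n).
    by apply: p_congX x2; rewrite ?rpredN ?rpred1.
  have := p_cong_trans (p_cong_sym (fermat_cong p_pr p_gt3 cop)) (_ : p_cong p 1 _ (-1)).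
  have -> : (x%:R ^+ p.-1 : rat) = (x%:R ^+ 2) ^+ n.
    by rewrite -exprM; congr (_ ^+ _); rewrite p_eq mul2n.
  move: xp; rewrite -signr_odd odd_n expr1 => xp /(_ xp) h.
  have : (p %| 2)%N by apply: p_cong_dvdn; rewrite /p_cong subr0; rewrite /p_cong opprK in h.
  by move=> /dvdn_leq -/(_ isT); rewrite leqNgt (ltn_trans _ p_gt3).
case: (boolP (odd n)) => // even_n; case: no_root.
exists (Ordinal (ltn_pmod n`! p_gt0)).
have : (p %| n`! ^ 2 + 1)%N.
  apply: p_cong_dvdn; have := factorial_square_cong.
  by rewrite -signr_odd (negbTE even_n) mul1r /p_cong opprK subr0 natrD natrX.
rewrite eqz_mod_dvd opprK /dvdn -modnDml -modnXm modnDml -/(dvdn p _).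
by rewrite -PoszD dvdzE.
Qed.

End Prime.

(** * The recurrence of the Euler numbers *)

Section PowerSeries.

Local Open Scope classical_set_scope.
Variable R : realType.
Implicit Types (a b c : nat -> R) (f g h : R -> R) (x : R) (P : {poly R}).

(** Small positive [x] suffice to determine the coefficients, and [1/2] lies inside the interval of
    [is_euler_numbers]. *)
Definition power_series_sum a f := forall x, 0 < x <= 1 / 2 ->
  series (fun n => a n * x ^+ n) @ \oo --> f x.

(** Convergence at [1/2] bounds [a n] by a multiple of [2^n]; for [x <= 1/4] the tail is dominated
    by a geometric series of ratio [2x <= 1/2]. *)
Lemma power_series_remainder a f N : power_series_sum a f ->
  exists2 K, 0 <= K & forall x, 0 < x <= 1 / 4 ->
    `|f x - (\poly_(i < N) a i).[x]| <= K * x ^+ N.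
Proof.
move=> cvf.
have [M M_bnd] : exists M, forall n, `|a n| <= M * 2 ^+ n.
  have c2 : series (fun n => a n * (1 / 2) ^+ n) @ \oo --> f (1 / 2).
    by apply: cvf; rewrite lexx andbT divr_gt0.
  have /cvg_series_bounded[M [_ hM]] := cvgP _ c2.
  exists (M + 1) => n; have := hM (M + 1) _ n; rewrite ltrDl ltr01 => /(_ isT Logic.I).
  by rewrite /= div1r exprVn normrM normfV normrX normr_nat ler_pdivrMr ?exprn_gt0.
have M_ge0 : 0 <= M by have := M_bnd 0%N; rewrite expr0 mulr1; apply: le_trans.
exists (2 * M * 2 ^+ N); first by rewrite !mulr_ge0 ?exprn_ge0.
move=> x /andP[x_gt0 x_le].
have cx : series (fun n => a n * x ^+ n) @ \oo --> f x by apply: cvf; rewrite x_gt0 /=; lra.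
have cd : (fun m => `|series (fun n => a n * x ^+ n) m - (\poly_(i < N) a i).[x]|) @ \oo -->
    `|f x - (\poly_(i < N) a i).[x]|.
  by apply: cvg_norm; apply: cvgB => //; exact: cvg_cst.
apply: (cvgr_to_le cd); exists N => // m /= le_Nm.
rewrite horner_poly -(big_mkord xpredT (fun i => a i * x ^+ i)).
rewrite -[\sum_(0 <= i < N) _]/(series (fun n => a n * x ^+ n) N) sub_series le_Nm.
apply: (le_trans (ler_norm_sum _ _ _)).
set y := 2 * x; have y_gt0 : 0 < y by rewrite mulr_gt0.
apply: (@le_trans _ _ (\sum_(N <= k < m) M * y ^+ k)).
  apply: ler_sum => k _; rewrite normrM normrX (gtr0_norm x_gt0) exprMn mulrA.
  by rewrite ler_wpM2r // exprn_ge0 // ltW.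
rewrite -mulr_sumr -mulrA -exprMn -/y [2 * M]mulrC -mulrA ler_wpM2l //.
have y1 : 1 - y > 0 by rewrite /y; lra.
have -> : \sum_(N <= k < m) y ^+ k = (y ^+ N - y ^+ m) / (1 - y).
  apply: (mulIf (lt0r_neq0 y1)); rewrite divfK ?lt0r_neq0 // mulr_suml.
  rewrite -[RHS]opprB -telescope_sumr // -sumrN; apply: eq_bigr => k _.
  by rewrite exprS; ring.
rewrite ler_pdivrMr //.
have yN : 0 <= y ^+ N by rewrite exprn_ge0 // ltW.
have ym : 0 <= y ^+ m by rewrite exprn_ge0 // ltW.
have y2 : y <= 1 / 2 by rewrite /y; lra.
nra.
Qed.

Lemma horner_bounded P : exists2 B, 0 <= B & forall x, 0 < x <= 1 / 4 -> `|P.[x]| <= B.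
Proof.
exists (\sum_(i < size P) `|P`_i|); first by rewrite sumr_ge0.
move=> x /andP[x_gt0 x_le]; rewrite horner_coef (le_trans (ler_norm_sum _ _ _)) //.
apply: ler_sum => i _; rewrite normrM normrX (gtr0_norm x_gt0).
by rewrite ler_piMr // exprn_ile1 ?ltW //; lra.
Qed.

(** Write [P = Q X + c]. The bound forces [c] to be at most a multiple of every small [x], hence
    [0]; dividing by [x] passes the estimate to [Q]. *)
Lemma poly_small_coef P K N :
  (forall x, 0 < x <= 1 / 4 -> `|P.[x]| <= K * x ^+ N) ->
  forall i, (i < N)%N -> P`_i = 0.
Proof.
elim: N P => // N IH P small.
have [Q [c PE]] : exists (Q : {poly R}) (c : R), P = Q * 'X + c%:P.
  by elim/poly_ind: (P) => [|Q c _]; [exists 0, 0; rewrite mul0r addr0|exists Q, c].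
have [B B_ge0 Q_bnd] := horner_bounded Q.
have c_bnd x : 0 < x <= 1 / 4 -> `|c| <= (`|K| + B) * x.
  move=> x_itv; have /andP[x_gt0 x_le] := x_itv.
  have -> : c = P.[x] - Q.[x] * x by rewrite PE !hornerE addrC addKr.
  rewrite (le_trans (ler_normB _ _)) // mulrDl lerD //.
    rewrite (le_trans (small x x_itv)) // exprS mulrA.
    have xN : 0 <= x ^+ N by rewrite exprn_ge0 // ltW.
    have xN1 : x ^+ N <= 1 by rewrite exprn_ile1 ?ltW //; lra.
    have Kx : K * x <= `|K| * x by rewrite ler_pM2r // ler_norm.
    have Kx0 : 0 <= `|K| * x by rewrite mulr_ge0 // ltW.
    nra.
  by rewrite normrM (gtr0_norm x_gt0) ler_pM2r // Q_bnd.
have c0 : c = 0.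
  apply/eqP; rewrite -normr_eq0 eq_le normr_ge0 andbT leNgt; apply/negP => c_gt0.
  set L := `|K| + B + 1.
  have L_gt0 : 0 < L by rewrite /L ltr_wpDl // addr_ge0.
  (* At this point the bound gives [|c| <= L x <= |c| / 2], and the minimum keeps [x] in range. *)
  pose x := Num.min (1 / 4) (`|c| / (2 * L)).
  have x_gt0 : 0 < x by rewrite lt_min divr_gt0 //= ?divr_gt0 // mulr_gt0.
  have x_le : x <= `|c| / (2 * L) by rewrite ge_min lexx orbT.
  have := c_bnd x; rewrite x_gt0 ge_min lexx /= => /(_ isT) h.
  have : `|c| <= `|c| / 2.
    apply: (le_trans h); apply: (@le_trans _ _ (L * x)).
      by rewrite ler_pM2r // /L lerDl.
    have -> : `|c| / 2 = L * (`|c| / (2 * L)) by field; rewrite lt0r_neq0.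
    by rewrite ler_pM2l.
  lra.
move=> [|i] lt_i; first by rewrite PE c0 addr0 coefMX.
rewrite PE c0 addr0 coefMX /=; apply: IH lt_i => x x_itv.
have /andP[x_gt0 _] := x_itv; have := small x x_itv.
rewrite PE c0 addr0 hornerM hornerX normrM (gtr0_norm x_gt0) exprSr mulrA.
by rewrite ler_pM2r.
Qed.

(** For the truncations below degree [n+1], [A B - C] is bounded by a multiple of [x^(n+1)], so its
    coefficient of degree [n] vanishes. *)
Lemma power_series_mul_coef a b c f g h :
  power_series_sum a f -> power_series_sum b g -> power_series_sum c h ->
  (forall x, 0 < x <= 1 / 2 -> f x * g x = h x) ->
  forall n, \sum_(k < n.+1) a k * b (n - k)%N = c n.
Proof.
move=> sf sg sh fg n.
have [Ka Ka0 ra] := power_series_remainder n.+1 sf.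
have [Kb Kb0 rb] := power_series_remainder n.+1 sg.
have [Kc Kc0 rc] := power_series_remainder n.+1 sh.
move: ra rb rc; set A := \poly_(i < _) a i; set B := \poly_(i < _) b i.
set C := \poly_(i < _) c i => ra rb rc.
have [Ba Ba0 bA] := horner_bounded A; have [Bb Bb0 bB] := horner_bounded B.
have small x : 0 < x <= 1 / 4 ->
    `|(A * B - C).[x]| <= (Ba * Kb + Ka * (Bb + Kb) + Kc) * x ^+ n.+1.
  move=> x_itv; have /andP[x_gt0 x_le] := x_itv.
  have xN0 : 0 <= x ^+ n.+1 by rewrite exprn_ge0 // ltW.
  have xN1 : x ^+ n.+1 <= 1 by rewrite exprn_ile1 ?ltW //; lra.
  have g_bnd : `|g x| <= Bb + Kb.
    rewrite -(subrK B.[x] (g x)) addrC (le_trans (ler_normD _ _)) // lerD ?bB //.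
    by rewrite (le_trans (rb x x_itv)) // ler_piMr.
  have -> : (A * B - C).[x] =
      (h x - C.[x]) - A.[x] * (g x - B.[x]) - (f x - A.[x]) * g x.
    by rewrite !hornerE -fg ?x_gt0 /=; [ring|lra].
  have -> : (Ba * Kb + Ka * (Bb + Kb) + Kc) * x ^+ n.+1 =
      Kc * x ^+ n.+1 + Ba * (Kb * x ^+ n.+1) + Ka * x ^+ n.+1 * (Bb + Kb) by ring.
  rewrite (le_trans (ler_normB _ _)) // lerD //; last first.
    by rewrite normrM; apply: ler_pM => //; exact: ra.
  rewrite (le_trans (ler_normB _ _)) // lerD ?rc //.
  by rewrite normrM; apply: ler_pM => //; [exact: bA|exact: rb].
have := poly_small_coef small (ltnSn n).
rewrite coefB coefM coef_poly ltnSn => /eqP; rewrite subr_eq0 => /eqP <-.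
apply: eq_bigr => k _; rewrite !coef_poly ltn_ord ltnS leq_subr //.
Qed.

End PowerSeries.

Section EulerNumbers.

Local Open Scope classical_set_scope.

(** The generating function satisfies [f(x) e^(2x) = 2 e^x - f(x)]. The coefficients of [x^m] times
    [m!] give the recurrence in [R], and injectivity of [ratr] brings it back to [rat]. *)
Lemma euler_numbers_rec (R : realType) (E : nat -> rat) : is_euler_numbers R E ->
  euler_rec E.
Proof.
move=> eulerE m; rewrite /umbral.
pose a n : R := ratr (E n) / n`!%:R.
pose b n : R := 2 ^+ n / n`!%:R.
pose c n : R := 2 / n`!%:R - a n.
pose f (x : R) := 2 * expR x / (expR (2 * x) + 1).
have exp_series (y : R) : series (exp_coeff y) @ \oo --> expR y by exact: is_cvg_series_exp_coeff.
have sf : power_series_sum a f.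
  move=> x /andP[x_gt0 x_le].
  have -> : (fun n => a n * x ^+ n) = (fun n => ratr (E n) * (x ^+ n / n`!%:R)).
    by apply/funext => n; rewrite /a mulrAC mulrA.
  apply: eulerE; rewrite (gtr0_norm x_gt0); have := pi_ge2 R; lra.
have sg : power_series_sum b (fun x => expR (2 * x)).
  move=> x _; have -> : (fun n => b n * x ^+ n) = exp_coeff (2 * x); last exact: exp_series.
  by apply/funext => n; rewrite /b /exp_coeff /= exprMn mulrAC.
have sh : power_series_sum c (fun x => 2 * expR x - f x).
  move=> x x_itv.
  have -> : series (fun n => c n * x ^+ n) =
      (fun m => 2 * series (exp_coeff x) m - series (fun n => a n * x ^+ n) m).
    apply/funext => j; rewrite /series /= mulr_sumr -sumrB; apply: eq_bigr => k _.
    by rewrite /c /exp_coeff /= mulrBl; congr (_ - _); rewrite mulrA mulrAC.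
  apply: cvgB; last exact: sf.
  by apply: cvgM; [exact: cvg_cst|exact: exp_series].
have fg x : 0 < x <= 1 / 2 -> f x * expR (2 * x) = 2 * expR x - f x.
  by move=> _; rewrite /f; have := expR_gt0 (2 * x) => ?; field; rewrite lt0r_neq0 // addr_gt0.
have := power_series_mul_coef sf sg sh fg m; rewrite /a /b /c => e.
have fact_nz k : (k`!%:R : R) != 0 by rewrite pnatr_eq0 -lt0n fact_gt0.
apply: (fmorph_inj (@ratr R)); rewrite rmorphD rmorph_sum /= rmorph_nat.
have -> : \sum_(k < m.+1) ratr ('C(m, k)%:R * 2 ^+ (m - k) * E k)
  = m`!%:R * \sum_(k < m.+1) (ratr (E k) / k`!%:R * (2 ^+ (m - k) / (m - k)`!%:R)) :> R.
  rewrite mulr_sumr; apply: eq_bigr => k _.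
  have le_km : (k <= m)%N by rewrite -ltnS.
  rewrite !rmorphM rmorphXn /= !rmorph_nat -(bin_fact le_km).
  by rewrite !natrM; field; rewrite !fact_nz.
by rewrite e /a; field; rewrite fact_nz.
Qed.

End EulerNumbers.

Theorem theorem1p1 (R : realType) (E : nat -> rat) (p : nat) :
  is_euler_numbers R E -> prime p -> (3 < p)%N ->
  p_congr p (p ^ 4)%N
    (\sum_(0 <= k < ((p + 1) %/ 2).+1)
       (3 * k%:R - 1) *
       (pochhammer (- (1 / 2)) k ^+ 2 * pochhammer (1 / 2) k * 4 ^+ k
        / k`!%:R ^+ 3))
    (p%:R - 6 * p%:R ^+ 3 * (legendre (-1) p)%:~R
     + 2 * p%:R ^+ 3 * (legendre (-1) p)%:~R * E (p - 3)%N).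
Proof.
move=> /euler_numbers_rec recE p_pr p_gt3; have p_gt0 := prime_gt0 p_pr.
have odd_p : odd p by case: (even_prime p_pr) p_gt3 => // ->.
pose n := p./2; have p_eq : p = n.*2.+1 by rewrite /n -add1n -[LHS]odd_double_half odd_p.
have -> : ((p + 1) %/ 2 = n.+1)%N by rewrite p_eq; lia.
rewrite big_mkord sum_shifted (legendreN1 p_pr p_eq p_gt3) rmorphXn rmorphN1 /=.
set S := _ - _; set T := _ + _.
have T_int : T \in p_integral p.
  rewrite rpredD ?rpredB ?rpredM ?rpredX ?rpredN ?rpred_nat ?rpred1 //.
  exact: (euler_integral recE p_pr p_eq p_gt3).
have ST : p_cong p 4 S T.
  have -> : T = p%:R + p%:R ^+ 3 * (2 * (-1) ^+ n * E (p - 3)%N)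
      + - (6 * p%:R ^+ 3 * (-1) ^+ n) by rewrite /T; ring.
  (* The summand [k = n+1] is split off: what precedes it is [param_sum n 0], and it goes with the
     Gosper term into [boundary_cong]. *)
  rewrite /S big_ord_recr -addrA -param_sum0E /=.
  apply: p_congD; last exact: boundary_cong.
  apply: p_cong_trans (param_sum0_cong p_pr p_eq p_gt3) _.
  apply: p_congD; first exact: p_cong_refl.
  apply: (p_cong_scale p_gt0 3 (k := 1)); exact: quarter_sum_euler.
split=> //; first exact: (p_cong_integral p_gt0 ST T_int).
have /p_congP-/(_ p_gt0)[z z_int ->] := ST.
by exists z => //; rewrite natrX addrC addKr.
Qed.
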